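(* Let $k,m>0$ and let $q_0$ satisfy $1+4k<4q_0$; put $\mu=\frac12\sqrt{4(q_0-k)-1}$. Consider the Sturm-Liouville problem in Liouville normal form $$\text{(N)}\qquad -\frac{d^2v}{dt^2}+\frac{k}{(t+m)^2}v=\lambda v,\quad 0<t<\pi,\qquad v(0)=0=v(\pi),$$ with constant potential function $q=q_0$, density function $r=\tau^2$, where $\tau=t+m$, and $\overline\omega=\overline\omega_2(\tau)=\sqrt\tau\,\sin(\mu\ln\tau)$. Assume $\mu\ln m\neq n\pi$ and $\mu\ln(\pi+m)\neq n\pi$ for all $n\in\mathbb Z$. Then for every $x_0\in\mathbb R$, (N) has, asymptotically (to leading order about $\tau=1$), the canonical form $$-\frac{d}{dx}\left(\sin^4\left\{\mu\ln\left(1+\sqrt[3]{\tfrac{3}{\mu^2}(x+x_0)}\right)\right\}\frac{du}{dx}\right)+q_0\,u=\lambda\left(1+\sqrt[3]{\tfrac{3}{\mu^2}(x+x_0)}\right)^2u,\qquad a<x<b,$$ with Dirichlet boundary conditions $u(a)=0=u(b)$, where $$a=-x_0+\frac{\mu^2}{3}(m-1)^3,\qquad b=-x_0+\frac{\mu^2}3(\pi+m-1)^3,$$ $$\delta_0=m\sin^2(\mu\ln m),\qquad \gamma_0=(\pi+m)\sin^2[\mu\ln(\pi+m)].$$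
   Context: Cube roots are real cube roots. A canonical form is a problem $-(p\,u')'+q\,u=\lambda r\,u$ on $a<x<b$ with boundary conditions $\delta_0u(a)=0=\gamma_0u(b)$. It is produced from (N) by Liouville's transformation as follows: for given $q,r$ (as functions of $\tau=t+m$) take a nonzero real solution $\overline\omega=1/w$ of $$\frac{1}{\overline\omega}\frac{d^2\overline\omega}{d\tau^2}+\frac qr=\frac{k}{\tau^2},$$ put $p=\overline\omega^{\,4}/r$ and $u=wv$, and let $x$ be determined by $\frac{dx}{d\tau}=\sqrt{p/r}=\overline\omega^{\,2}/r$, i.e. $x+x_0=F(\tau)$ with $F$ an antiderivative of $\overline\omega^{\,2}/r$. (Relations are understood where $\overline\omega\ne0$.) Boundary coefficients: $\delta_0=\overline\omega^{\,2}$ at $\tau=m$ ($t=0$) and $\gamma_0=\overline\omega^{\,2}$ at $\tau=\pi+m$ ($t=\pi$); the conditions are Dirichlet, $u(a)=0=u(b)$, when $\delta_0,\gamma_0\neq0$. ''Asymptotically, to leading order about $\tau=1$'' means: $F$ is normalized by $F(1)=0$ and the exact relation $x+x_0=F(\tau)$ is replaced by $x+x_0=F_{\mathrm{lead}}(\tau)$, where $F_{\mathrm{lead}}$ is the lowest-order nonvanishing term of the Taylor expansion of $F$ about $\tau=1$. The functions $p,r$ are expressed in $x$, and the endpoints $a,b$ corresponding to $\tau=m,\pi+m$ are computed, by means of this leading-order relation. *)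

(* Defs.v *)
(* Stdlib reals with Coquelicot. *)
From Stdlib Require Import Reals Lra Factorial.
From Coquelicot Require Import Coquelicot.
Open Scope R_scope.

(* [Rpower] is only meaningful on positive bases ([Rpower 0 y = 1]); [sign 0 = 0]
   gives the right value at 0. *)
Definition cbrt (x : R) : R := sign x * Rpower (Rabs x) (1 / 3).

Lemma cbrt_pow3 (x : R) : cbrt x ^ 3 = x.
Proof.
  assert (H : forall y, 0 < y -> Rpower y (1 / 3) ^ 3 = y).
  { intros y Hy. rewrite <- Rpower_pow by apply exp_pos.
    rewrite Rpower_mult. replace (1 / 3 * INR 3) with 1 by (simpl; lra).
    now apply Rpower_1. }
  unfold cbrt. destruct (Rtotal_order x 0) as [Hx | [Hx | Hx]].
  - rewrite (sign_eq_m1 x Hx), (Rabs_left x Hx), Rpow_mult_distr, H; lra.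
  - subst x. rewrite sign_0. ring.
  - rewrite (sign_eq_1 x Hx), (Rabs_right x), Rpow_mult_distr, H; lra.
Qed.

(* The problem -(p u')' + q u = lambda r u on a < x < b,
   delta u(a) = 0 = gamma u(b). *)
Record SL_problem := mkSL {
  sl_p : R -> R;
  sl_q : R -> R;
  sl_r : R -> R;
  sl_a : R;
  sl_b : R;
  sl_delta : R;
  sl_gamma : R
}.

Definition sl_regular_at (P : SL_problem) (u : R -> R) (x : R) : Prop :=
  locally x (fun y => ex_derive u y) /\
  ex_derive (fun y => sl_p P y * Derive u y) x.

Definition sl_equation_at (P : SL_problem) (lambda : R) (u : R -> R) (x : R) : Prop :=
  sl_regular_at P u x /\
  - Derive (fun y => sl_p P y * Derive u y) x + sl_q P x * u x
    = lambda * sl_r P x * u x.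

Definition sl_boundary (P : SL_problem) (u : R -> R) : Prop :=
  sl_delta P * u (sl_a P) = 0 /\ sl_gamma P * u (sl_b P) = 0.

Definition normal_form (k m : R) : SL_problem := {|
  sl_p := fun _ => 1;
  sl_q := fun t => k / (t + m) ^ 2;
  sl_r := fun _ => 1;
  sl_a := 0;
  sl_b := PI;
  sl_delta := 1;
  sl_gamma := 1
|}.

(* [om] is a nonzero solution on tau > 0 of om''/om + q/r = Q(tau - m), Q being the
   potential of the normal form [N] and t = tau - m its independent variable; for
   [normal_form k m] the right-hand side is k / tau^2. *)
Definition liouville_solution (m : R) (q r : R -> R) (N : SL_problem) (om : R -> R) : Prop :=
  (exists tau, 0 < tau /\ om tau <> 0) /\
  (forall tau, 0 < tau -> ex_derive_n om 1 tau /\ ex_derive_n om 2 tau) /\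
  (forall tau, 0 < tau -> om tau <> 0 ->
     / om tau * Derive_n om 2 tau + q tau / r tau = sl_q N (tau - m)).

(* The change of variable x + x0 = F(tau), dx/dtau = sqrt (p/r) = om^2/r, normalized
   at tau = 1. *)
Definition liouville_variable (r om F : R -> R) : Prop :=
  F 1 = 0 /\ forall tau, 0 < tau -> is_derive F tau (om tau ^ 2 / r tau).

(* [C] has the coefficients, interval and boundary coefficients that Liouville's
   transformation of [N] prescribes, with x and tau = t + m related by
   x + x0 = G(tau). *)
Definition liouville_data (m : R) (q r om : R -> R) (x0 : R) (G : R -> R)
    (N C : SL_problem) : Prop :=
  (forall x, sl_a C < x < sl_b C <->
     exists tau, sl_a N + m < tau < sl_b N + m /\ x + x0 = G tau) /\
  (forall x tau, sl_a N + m < tau < sl_b N + m -> x + x0 = G tau ->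
     sl_p C x = om tau ^ 4 / r tau /\ sl_q C x = q tau /\ sl_r C x = r tau) /\
  sl_a C + x0 = G (sl_a N + m) /\
  sl_b C + x0 = G (sl_b N + m) /\
  sl_delta C = om (sl_a N + m) ^ 2 /\
  sl_gamma C = om (sl_b N + m) ^ 2.

(* With w = 1/om, the substitution u = w v under the exact relation x + x0 = F(tau)
   turns the differential equation of [N] into that of [C], wherever om <> 0. *)
Definition liouville_substitution (m : R) (om : R -> R) (x0 : R) (F : R -> R)
    (N C : SL_problem) : Prop :=
  forall (lambda : R) (u v : R -> R),
    (forall t, sl_a N < t < sl_b N -> om (t + m) <> 0 ->
       u (F (t + m) - x0) = / om (t + m) * v t) ->
    forall t, sl_a N < t < sl_b N -> om (t + m) <> 0 ->
      sl_regular_at C u (F (t + m) - x0) ->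
      (sl_equation_at N lambda v t <-> sl_equation_at C lambda u (F (t + m) - x0)).

(* [L] is the lowest-order nonvanishing Taylor term of [F] about [c]. *)
Definition taylor_leading_term (F : R -> R) (c : R) (L : R -> R) : Prop :=
  exists (n : nat) (d : R),
    (forall j, (j < n)%nat -> is_derive_n F j c 0) /\
    is_derive_n F n c d /\ d <> 0 /\
    forall tau, L tau = d / INR (fact n) * (tau - c) ^ n.

(* The data of [C] are computed with the leading-order relation x + x0 = F_lead(tau) in
   place of x + x0 = F(tau). The substitution u = w v is valid only for the exact
   relation, hence is required of the exact canonical form [E]. *)
Definition asymptotic_canonical_form (m : R) (q r om : R -> R) (x0 : R)
    (N C : SL_problem) : Prop :=
  liouville_solution m q r N om /\
  exists F Flead : R -> R,
    liouville_variable r om F /\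
    (exists E, liouville_data m q r om x0 F N E /\
               liouville_substitution m om x0 F N E) /\
    taylor_leading_term F 1 Flead /\
    liouville_data m q r om x0 Flead N C.

(* Main.v *)
Require Import Defs.
From Stdlib Require Import Reals Lra Lia ClassicalEpsilon.
From Coquelicot Require Import Coquelicot.
Open Scope R_scope.

(* On omega_2^2 / r = sin^2 (mu ln tau) / tau one integrates in the variable ln tau: the
   exact change of variable is F = ln tau / 2 - sin (2 mu ln tau) / (4 mu). It is strictly
   increasing, since sin y - sin x < y - x for x < y, so the exact canonical form exists;
   F' vanishes to second order at tau = 1, with F'''(1) = 2 mu^2, whence
   F_lead = mu^2 / 3 (tau - 1)^3, which is inverted by a cube root. *)

(** * Strictly increasing changes of variable *)

(** The difference of sines is 2 cos c sin h with c the midpoint and h half the distance; then |cos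
    c| <= 1 and |sin h| < h. *)
Lemma sin_sub_lt (x y : R) : x < y -> sin y - sin x < y - x.
Proof.
  intros Hxy. rewrite form4.
  set (c := (y + x) / 2). set (h := (y - x) / 2).
  assert (Hh : 0 < h) by (unfold h; lra).
  replace (y - x) with (2 * h) by (unfold h; field).
  assert (Hs : - h < sin h < h).
  { split; [|now apply sin_lt_x].
    (* For the lower bound, the sine is nonnegative up to PI; beyond PI, sin h >= -1 > -h. *)
    destruct (Rle_lt_dec h PI) as [HP | HP].
    - pose proof (sin_ge_0 h (Rlt_le _ _ Hh) HP). lra.
    - pose proof (SIN_bound h). pose proof PI2_1. lra. }
  pose proof (COS_bound c). destruct (Rle_lt_dec 0 (sin h)); nra.
Qed.

Lemma is_derive_shift (f : R -> R) (c x l : R) :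
  is_derive f (x + c) l -> is_derive (fun y => f (y + c)) x l.
Proof.
  intros Hf. evar_last.
  { apply (is_derive_comp f (fun y => y + c)); [exact Hf|].
    auto_derive; [exact I | reflexivity]. }
  apply Rmult_1_l.
Qed.

(** A choice operator picks a positive preimage, and strict monotonicity makes it unique. Outside
    the image of the positive half-line the value is arbitrary. *)
Lemma increasing_left_inverse (F : R -> R) :
  (forall s t, 0 < s -> s < t -> F s < F t) ->
  exists T : R -> R, forall tau, 0 < tau -> T (F tau) = tau.
Proof.
  intros HF.
  exists (fun y => epsilon (inhabits 0) (fun tau => 0 < tau /\ F tau = y)).
  intros tau Htau.
  destruct (epsilon_spec (inhabits 0) (fun s => 0 < s /\ F s = F tau)) as [Hs HFs].
  { now exists tau. }
  set (s := epsilon _ _) in *.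
  destruct (Rtotal_order s tau) as [Hlt | [Heq | Hlt]]; [| exact Heq |];
    apply HF in Hlt; lra.
Qed.

(** The intermediate value theorem gives every x of the interval a tau, and monotonicity keeps the
    images of interior tau inside. The coefficients then need checking only along x = G(tau) - x0.
    Both the exact and the leading-order relation are treated this way. *)
Lemma increasing_liouville_data (m : R) (q r om : R -> R) (x0 : R) (G : R -> R)
    (N C : SL_problem) :
  0 < sl_a N + m -> sl_a N < sl_b N ->
  (forall s t, 0 < s -> s < t -> G s < G t) ->
  (forall t, 0 < t -> ex_derive G t) ->
  (forall tau, 0 < tau ->
     sl_p C (G tau - x0) = om tau ^ 4 / r tau /\
     sl_q C (G tau - x0) = q tau /\ sl_r C (G tau - x0) = r tau) ->
  sl_a C = G (sl_a N + m) - x0 ->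
  sl_b C = G (sl_b N + m) - x0 ->
  sl_delta C = om (sl_a N + m) ^ 2 ->
  sl_gamma C = om (sl_b N + m) ^ 2 ->
  liouville_data m q r om x0 G N C.
Proof.
  intros Ha Hab HG HdG Hcoef Hca Hcb Hd Hg.
  assert (Hc : forall t, 0 < t -> continuity_pt G t).
  { intros t Ht. apply continuity_pt_filterlim.
    now apply (ex_derive_continuous (K := R_AbsRing) (V := R_NormedModule)), HdG. }
  repeat split; try lra.
  - intros Hx.
    destruct (IVT_Rbar_incr G (sl_a N + m) (sl_b N + m)
                (G (sl_a N + m)) (G (sl_b N + m)) (x + x0)) as [tau [H1 [H2 H3]]].
    + apply is_lim_continuity, Hc; lra.
    + apply is_lim_continuity, Hc; lra.
    + simpl. intros t Ht _. apply Hc; lra.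
    + simpl; lra.
    + simpl; lra.
    + exists tau. simpl in H1, H2. split; [lra | now symmetry].
  - destruct H as [tau [Htau Hx]].
    assert (G (sl_a N + m) < G tau) by (apply HG; lra). lra.
  - destruct H as [tau [Htau Hx]].
    assert (G tau < G (sl_b N + m)) by (apply HG; lra). lra.
  - replace x with (G tau - x0) by lra. apply Hcoef; lra.
  - replace x with (G tau - x0) by lra. apply Hcoef; lra.
  - replace x with (G tau - x0) by lra. apply Hcoef; lra.
Qed.

(** * Liouville's transformation under the exact relation *)

(* With tau = t + m, v = om u and W = p u', one has v' = om' u + W / om and
   v'' = om'' u + (om / r) W': the first-order terms cancel. *)
Lemma liouville_substitution_exact (m : R) (q r om : R -> R) (x0 : R) (F : R -> R)
    (N E : SL_problem) :
  0 <= sl_a N + m ->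
  (forall t, sl_p N t = 1) -> (forall t, sl_r N t = 1) ->
  (forall tau, 0 < tau -> 0 < r tau) ->
  liouville_solution m q r N om ->
  liouville_variable r om F ->
  liouville_data m q r om x0 F N E ->
  liouville_substitution m om x0 F N E.
Proof.
  intros Ha HpN HrN Hr [_ [Hom Hode]] [_ HF] [_ [Hcoef _]]
    lambda u v Huv t Ht Hwt [Hu HW].
  set (X := fun s => F (s + m) - x0).
  change (F (t + m) - x0) with (X t) in *.
  set (W := fun y => sl_p E y * Derive u y) in *.
  assert (Hvu : forall s, sl_a N < s < sl_b N -> om (s + m) <> 0 ->
            v s = om (s + m) * u (X s)).
  { intros s Hs Hws. unfold X. rewrite Huv by assumption. field. exact Hws. }
  assert (HX : forall s, sl_a N < s -> is_derive X s (om (s + m) ^ 2 / r (s + m))).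
  { intros s Hs. unfold X.
    pose proof (is_derive_shift F m s _ (HF (s + m) ltac:(lra))) as HFs.
    evar_last.
    { apply (is_derive_minus (K := R_AbsRing) (V := R_NormedModule)).
      - exact HFs.
      - apply is_derive_const. }
    unfold minus, plus, opp, zero; simpl. ring. }
  assert (Homs : forall s, sl_a N < s ->
            is_derive (fun s => om (s + m)) s (Derive om (s + m))).
  { intros s Hs. apply is_derive_shift, Derive_correct, (Hom (s + m)). lra. }
  assert (Hdoms : is_derive (fun s => Derive om (s + m)) t (Derive_n om 2 (t + m))).
  { apply is_derive_shift. apply (Derive_correct (Derive om)), (Hom (t + m)). lra. }
  (* A second derivative at t needs v' on a neighbourhood of t; the conditions om <> 0 and
     differentiability of u are pulled back to one by continuity of om and of X. *)
  assert (Hgood : locally t (fun s =>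
            (sl_a N < s < sl_b N /\ om (s + m) <> 0) /\ ex_derive u (X s))).
  { apply filter_and; [apply filter_and|].
    - apply (locally_interval _ t (sl_a N) (sl_b N)); simpl; try lra.
      intros y H1 H2. split; assumption.
    - refine (ex_derive_continuous (fun s => om (s + m)) t _ (fun y => y <> 0) _).
      + eexists. apply Homs. lra.
      + now apply open_neq.
    - refine (ex_derive_continuous X t _ (fun y => ex_derive u y) Hu).
      eexists. apply HX. lra. }
  (* This is v': since X' = om^2 / r and p = om^4 / r, the term om u' X' equals p u' / om = W /
     om. *)
  set (v1 := fun s => Derive om (s + m) * u (X s) + / om (s + m) * W (X s)).
  assert (Hv1 : locally t (fun s => is_derive v s (v1 s))).
  { apply locally_locally in Hgood. revert Hgood.
    apply filter_imp. intros s Hs.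
    destruct (locally_singleton _ _ Hs) as [[Hsab Hws] Hus].
    apply (is_derive_ext_loc (fun s => om (s + m) * u (X s))).
    { revert Hs. apply filter_imp. intros y [[Hy Hwy] _].
      symmetry. now apply Hvu. }
    evar_last.
    { apply (is_derive_mult (fun s => om (s + m)) (fun s => u (X s))).
      - apply Homs. lra.
      - apply is_derive_comp; [apply Derive_correct, Hus | apply HX; lra].
      - intros; apply Rmult_comm. }
    unfold v1, W, X.
    destruct (Hcoef (F (s + m) - x0) (s + m)) as [Hp _]; [lra | ring |].
    rewrite Hp. unfold plus, mult, scal; simpl. unfold mult; simpl.
    assert (r (s + m) <> 0) by (apply Rgt_not_eq, Hr; lra).
    field; split; assumption. }
  pose proof (Hvu t Ht Hwt) as Hvt.
  assert (Hrt : 0 < r (t + m)) by (apply Hr; lra).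
  destruct (Hcoef (X t) (t + m)) as [Hp [Hq Hre]]; [lra | unfold X; ring |].
  assert (Hpv : locally t (fun s => v1 s = sl_p N s * Derive v s)).
  { revert Hv1. apply filter_imp. intros s Hs.
    rewrite HpN, (is_derive_unique _ _ _ Hs). ring. }
  assert (Hv2 : is_derive (fun s => sl_p N s * Derive v s) t
            (Derive_n om 2 (t + m) * u (X t) + om (t + m) / r (t + m) * Derive W (X t))).
  { apply (is_derive_ext_loc v1); [exact Hpv|]. unfold v1.
    evar_last.
    { apply (is_derive_plus (K := R_AbsRing) (V := R_NormedModule)).
      - apply (is_derive_mult (fun s => Derive om (s + m)) (fun s => u (X s))).
        + apply Hdoms.
        + apply is_derive_comp; [apply Derive_correct, (locally_singleton _ _ Hu)
                                | apply HX; lra].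
        + intros; apply Rmult_comm.
      - apply (is_derive_mult (fun s => / om (s + m)) (fun s => W (X s))).
        + apply (is_derive_inv (fun s => om (s + m))); [apply Homs; lra | exact Hwt].
        + apply is_derive_comp; [apply Derive_correct, HW | apply HX; lra].
        + intros; apply Rmult_comm. }
    unfold plus, mult, scal; simpl. unfold mult; simpl.
    unfold W at 1. rewrite Hp.
    field. split; [lra | exact Hwt]. }
  (* Regularity of u is assumed; that of v follows from the two derivatives just computed. *)
  assert (HregN : sl_regular_at N v t).
  { split; [| now eexists; eauto].
    revert Hv1. apply filter_imp. intros s Hs. now eexists; eauto. }
  assert (HQ : sl_q N t = / om (t + m) * Derive_n om 2 (t + m) + q (t + m) / r (t + m)).
  { rewrite Hode by (assumption || lra). f_equal. ring. }
  unfold sl_equation_at. fold W.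
  replace (Derive (fun s : R => sl_p N s * Derive v s) t)
    with (Derive_n om 2 (t + m) * u (X t) + om (t + m) / r (t + m) * Derive W (X t))
    by (symmetry; exact (is_derive_unique _ _ _ Hv2)).
  rewrite HQ, Hvt, HrN, Hq, Hre.
  set (u'' := Derive W (X t)). set (om'' := Derive_n om 2 (t + m)).
  (* The residual of the normal form is om / r times the residual of the transformed equation; this
     factor is nonzero, so both vanish together. *)
  assert (Hid : forall lam,
    - (om'' * u (X t) + om (t + m) / r (t + m) * u'')
      + (/ om (t + m) * om'' + q (t + m) / r (t + m)) * (om (t + m) * u (X t))
      - lam * 1 * (om (t + m) * u (X t))
    = om (t + m) / r (t + m) *
      (- u'' + q (t + m) * u (X t) - lam * r (t + m) * u (X t))).
  { intros lam. field. split; [lra | exact Hwt]. }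
  specialize (Hid lambda).
  split; intros [_ Heq].
  - split; [split; assumption|].
    apply Rminus_diag_uniq.
    apply Rmult_eq_reg_l with (om (t + m) / r (t + m)).
    + rewrite Rmult_0_r, <- Hid. lra.
    + apply Rmult_integral_contrapositive_currified; [exact Hwt|].
      apply Rinv_neq_0_compat. lra.
  - split; [exact HregN|].
    apply Rminus_diag_uniq. rewrite Hid.
    replace (- u'' + _ - _) with 0 by lra. ring.
Qed.

(** The coefficients are composed with a left inverse [T] of F. This suffices because they are
    prescribed only at points with x + x0 = F(tau), tau > 0. *)
Lemma exists_exact_canonical_form (m : R) (q r om : R -> R) (x0 : R) (F : R -> R)
    (N : SL_problem) :
  0 < sl_a N + m -> sl_a N < sl_b N ->
  (forall t, sl_p N t = 1) -> (forall t, sl_r N t = 1) ->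
  (forall tau, 0 < tau -> 0 < r tau) ->
  liouville_solution m q r N om ->
  liouville_variable r om F ->
  (forall s t, 0 < s -> s < t -> F s < F t) ->
  exists E, liouville_data m q r om x0 F N E /\
            liouville_substitution m om x0 F N E.
Proof.
  intros Ha Hab HpN HrN Hr Hsol HF Hincr.
  destruct (increasing_left_inverse F Hincr) as [T HT].
  set (E := {|
    sl_p := fun x => om (T (x + x0)) ^ 4 / r (T (x + x0));
    sl_q := fun x => q (T (x + x0));
    sl_r := fun x => r (T (x + x0));
    sl_a := F (sl_a N + m) - x0;
    sl_b := F (sl_b N + m) - x0;
    sl_delta := om (sl_a N + m) ^ 2;
    sl_gamma := om (sl_b N + m) ^ 2 |}).
  assert (HE : liouville_data m q r om x0 F N E).
  { apply increasing_liouville_data; try reflexivity; try assumption.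
    - intros t Ht. eexists. now apply HF.
    - intros tau Htau. simpl.
      replace (F tau - x0 + x0) with (F tau) by ring.
      rewrite HT by assumption. repeat split. }
  exists E. split; [exact HE|].
  apply (liouville_substitution_exact m q r); try assumption; lra.
Qed.

(** * The cube root, the solution of the Euler equation and the exact phase *)

Lemma cbrt_of_pow3 (x : R) : cbrt (x ^ 3) = x.
Proof.
  pose proof (cbrt_pow3 (x ^ 3)) as H.
  set (y := cbrt (x ^ 3)) in *.
  assert (Hf : (y - x) * (y * y + y * x + x * x) = 0) by (ring_simplify; lra).
  destruct (Rmult_integral _ _ Hf) as [H0 | H0]; [lra|].
  (* Four times the quadratic factor is (2y + x)^2 + 3x^2, and also (y + 2x)^2 + 3y^2, so its
     vanishing forces x = y = 0. *)
  pose proof (Rle_0_sqr (2 * y + x)). pose proof (Rle_0_sqr (y + 2 * x)).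
  unfold Rsqr in *.
  rewrite (Rsqr_0_uniq x), (Rsqr_0_uniq y); unfold Rsqr; nra.
Qed.

(** The imaginary part of tau^(1/2 + i mu), a solution of the Euler equation om'' + (mu^2 + 1/4) om
    / tau^2 = 0. *)
Definition log_oscillation (mu tau : R) : R := sqrt tau * sin (mu * ln tau).

Lemma log_oscillation_sq (mu tau : R) :
  0 < tau -> log_oscillation mu tau ^ 2 = tau * sin (mu * ln tau) ^ 2.
Proof.
  intros Htau. unfold log_oscillation.
  rewrite Rpow_mult_distr, pow2_sqrt by lra. reflexivity.
Qed.

Lemma log_oscillation_pow4 (mu tau : R) :
  0 < tau -> log_oscillation mu tau ^ 4 / tau ^ 2 = sin (mu * ln tau) ^ 4.
Proof.
  intros Htau.
  replace (log_oscillation mu tau ^ 4) with ((log_oscillation mu tau ^ 2) ^ 2) by ring.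
  rewrite log_oscillation_sq by assumption. field. lra.
Qed.

Lemma is_derive_log_oscillation (mu tau : R) : 0 < tau ->
  is_derive (log_oscillation mu) tau
    ((1 / 2 * sin (mu * ln tau) + mu * cos (mu * ln tau)) / sqrt tau).
Proof.
  intros Htau. unfold log_oscillation.
  pose proof (sqrt_lt_R0 tau Htau). pose proof (sqrt_sqrt tau (Rlt_le _ _ Htau)) as Hs.
  auto_derive; [lra|].
  rewrite <- Hs at 4. field. lra.
Qed.

Lemma is_derive2_log_oscillation (mu tau : R) : 0 < tau ->
  is_derive (Derive (log_oscillation mu)) tau
    (- (mu ^ 2 + 1 / 4) / tau ^ 2 * log_oscillation mu tau).
Proof.
  intros Htau.
  apply (is_derive_ext_loc (fun tau =>
    (1 / 2 * sin (mu * ln tau) + mu * cos (mu * ln tau)) / sqrt tau)).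
  { apply (locally_interval _ tau 0 p_infty); simpl; auto.
    intros y Hy _. symmetry. now apply is_derive_unique, is_derive_log_oscillation. }
  pose proof (sqrt_lt_R0 tau Htau). pose proof (sqrt_sqrt tau (Rlt_le _ _ Htau)) as Hs.
  unfold log_oscillation. auto_derive; [repeat split; lra|].
  (* With sine, cosine and square root abstracted, writing tau as t * t leaves a rational
     identity. *)
  set (S := sin _). set (K := cos _). set (t := sqrt tau) in *.
  rewrite <- Hs. field. lra.
Qed.

Lemma log_oscillation_liouville_solution (mu k m q0 : R) :
  0 < mu -> mu ^ 2 = q0 - k - 1 / 4 ->
  liouville_solution m (fun _ => q0) (fun tau => tau ^ 2) (normal_form k m)
    (log_oscillation mu).
Proof.
  intros Hmu Hmu2. split; [|split].
  (* At this point mu ln tau = PI / 2, so the sine is 1. *)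
  - exists (exp (PI / 2 / mu)). pose proof (exp_pos (PI / 2 / mu)) as He.
    split; [exact He|]. unfold log_oscillation. rewrite ln_exp.
    replace (mu * (PI / 2 / mu)) with (PI / 2) by (field; lra).
    rewrite sin_PI2. pose proof (sqrt_lt_R0 _ He). lra.
  - intros tau Htau. split; eexists.
    + now apply is_derive_log_oscillation.
    + now apply is_derive2_log_oscillation.
  - intros tau Htau Hne. simpl sl_q.
    change (Derive_n (log_oscillation mu) 2 tau)
      with (Derive (Derive (log_oscillation mu)) tau).
    rewrite (is_derive_unique _ _ _ (is_derive2_log_oscillation mu tau Htau)), Hmu2.
    replace (tau - m + m) with tau by ring.
    field. split; lra || exact Hne.
Qed.

Definition log_phase (mu tau : R) : R :=
  ln tau / 2 - sin (2 * mu * ln tau) / (4 * mu).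

Lemma is_derive_log_phase (mu tau : R) : mu <> 0 -> 0 < tau ->
  is_derive (log_phase mu) tau (sin (mu * ln tau) ^ 2 / tau).
Proof.
  intros Hmu Htau. unfold log_phase. auto_derive; [repeat split; lra|].
  replace (2 * mu * ln tau) with (2 * (mu * ln tau)) by ring.
  rewrite cos_2a_sin. field. lra.
Qed.

Lemma log_phase_liouville_variable (mu : R) :
  mu <> 0 -> liouville_variable (fun tau => tau ^ 2) (log_oscillation mu) (log_phase mu).
Proof.
  intros Hmu. split.
  - unfold log_phase. rewrite ln_1, Rmult_0_r, sin_0. field. exact Hmu.
  - intros tau Htau. rewrite log_oscillation_sq by assumption.
    evar_last; [now apply is_derive_log_phase|]. field. lra.
Qed.

(** F' vanishes wherever mu ln tau is a multiple of PI, so strictness is taken from the sine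
    inequality at 2 mu ln tau instead of the sign of F'. *)
Lemma log_phase_increasing (mu s t : R) :
  0 < mu -> 0 < s -> s < t -> log_phase mu s < log_phase mu t.
Proof.
  intros Hmu Hs Hst. pose proof (ln_increasing s t Hs Hst) as Hln.
  pose proof (sin_sub_lt (2 * mu * ln s) (2 * mu * ln t) ltac:(nra)) as H.
  apply Rmult_lt_reg_l with (4 * mu); [lra|]. unfold log_phase.
  apply Rlt_0_minus.
  replace (_ - _) with (2 * mu * ln t - 2 * mu * ln s
    - (sin (2 * mu * ln t) - sin (2 * mu * ln s))) by (field; lra).
  lra.
Qed.

Lemma log_phase_leading_term (mu : R) :
  mu <> 0 -> taylor_leading_term (log_phase mu) 1 (fun tau => mu ^ 2 / 3 * (tau - 1) ^ 3).
Proof.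
  intros Hmu.
  assert (Hloc : forall (P : R -> Prop) c, 0 < c -> (forall y, 0 < y -> P y) -> locally c P).
  { intros P c Hc H. apply (locally_interval _ c 0 p_infty); simpl; auto. }
  (* An explicit F'' on tau > 0, from which F''(1) and F'''(1) are read off. *)
  set (d2 := fun tau => (2 * mu * sin (mu * ln tau) * cos (mu * ln tau)
                         - sin (mu * ln tau) ^ 2) / tau ^ 2).
  assert (H2 : forall tau, 0 < tau -> is_derive (Derive (log_phase mu)) tau (d2 tau)).
  { intros tau Htau.
    apply (is_derive_ext_loc (fun tau => sin (mu * ln tau) ^ 2 / tau)).
    - apply Hloc; [exact Htau|]. intros y Hy. symmetry.
      now apply is_derive_unique, is_derive_log_phase.
    - unfold d2. auto_derive; [repeat split; lra|]. field. lra. }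
  assert (Hs1 : sin (mu * ln 1) = 0) by (rewrite ln_1, Rmult_0_r; apply sin_0).
  assert (Hc1 : cos (mu * ln 1) = 1) by (rewrite ln_1, Rmult_0_r; apply cos_0).
  (* At tau = 1 the sine is 0 and the cosine 1, so only 2 mu^2 cos^2 survives in F'''; dividing by
     3! gives the coefficient mu^2 / 3. *)
  exists 3%nat, (2 * mu ^ 2). split; [|split; [|split]].
  - intros [|[|[|j]]] Hj.
    + apply (log_phase_liouville_variable mu Hmu).
    + change (is_derive (log_phase mu) 1 0).
      evar_last; [apply is_derive_log_phase; [exact Hmu | lra]|].
      rewrite Hs1. field.
    + change (is_derive (Derive (log_phase mu)) 1 0).
      evar_last; [apply H2; lra|]. unfold d2. rewrite Hs1. field.
    + exfalso. lia.
  - change (is_derive (Derive (Derive (log_phase mu))) 1 (2 * mu ^ 2)).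
    apply (is_derive_ext_loc d2).
    + apply Hloc; [lra|]. intros y Hy. symmetry. now apply is_derive_unique, H2.
    + unfold d2. auto_derive; [repeat split; lra|].
      rewrite Hs1, Hc1. field.
  - pose proof (pow_nonzero mu 2 Hmu). lra.
  - intros tau. simpl. field.
Qed.

(** * The canonical form to leading order *)

Theorem theorem7 (k m q0 mu : R)
  (hk : 0 < k) (hm : 0 < m) (hq0 : 1 + 4 * k < 4 * q0)
  (hmu : mu = 1 / 2 * sqrt (4 * (q0 - k) - 1))
  (hma : forall n : Z, mu * ln m <> IZR n * PI)
  (hmb : forall n : Z, mu * ln (PI + m) <> IZR n * PI)
  (x0 : R) :
  let C := {|
    sl_p := fun x => sin (mu * ln (1 + cbrt (3 / mu ^ 2 * (x + x0)))) ^ 4;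
    sl_q := fun _ => q0;
    sl_r := fun x => (1 + cbrt (3 / mu ^ 2 * (x + x0))) ^ 2;
    sl_a := - x0 + mu ^ 2 / 3 * (m - 1) ^ 3;
    sl_b := - x0 + mu ^ 2 / 3 * (PI + m - 1) ^ 3;
    sl_delta := m * sin (mu * ln m) ^ 2;
    sl_gamma := (PI + m) * sin (mu * ln (PI + m)) ^ 2
  |} in
  asymptotic_canonical_form m (fun _ => q0) (fun tau => tau ^ 2)
    (fun tau => sqrt tau * sin (mu * ln tau)) x0 (normal_form k m) C /\
  (forall u : R -> R, sl_boundary C u <-> u (sl_a C) = 0 /\ u (sl_b C) = 0).
Proof.
  intros C.
  change (fun tau => sqrt tau * sin (mu * ln tau)) with (log_oscillation mu).
  pose proof PI_RGT_0 as HPI.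
  assert (Hmu : 0 < mu).
  { rewrite hmu. pose proof (sqrt_lt_R0 (4 * (q0 - k) - 1) ltac:(lra)). lra. }
  assert (Hmu0 : mu <> 0) by lra.
  assert (Hmu2 : mu ^ 2 = q0 - k - 1 / 4).
  { rewrite hmu, Rpow_mult_distr, pow2_sqrt by lra. field. }
  pose proof (log_oscillation_liouville_solution mu k m q0 Hmu Hmu2) as Hsol.
  pose proof (log_phase_liouville_variable mu Hmu0) as HF.
  split.
  - split; [exact Hsol|].
    exists (log_phase mu), (fun tau => mu ^ 2 / 3 * (tau - 1) ^ 3).
    split; [exact HF|]. split; [|split].
    + apply exists_exact_canonical_form; simpl; try lra; try assumption; try reflexivity.
      * intros tau Htau. nra.
      * intros s t. now apply log_phase_increasing.
    + now apply log_phase_leading_term.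
    + apply increasing_liouville_data; simpl sl_a; simpl sl_b; try lra.
      * intros s t _ Hst. apply Rmult_lt_compat_l; [nra|].
        apply Rlt_0_minus.
        (* Difference of the cubes of t - 1 and s - 1, with the quadratic factor written as a sum of
           squares. *)
        replace (_ - _) with
          ((t - s) * ((t - s) ^ 2 / 4 + 3 * ((t + s - 2) ^ 2 / 4))) by field.
        pose proof (pow2_gt_0 (t - s) ltac:(lra)). pose proof (pow2_ge_0 (t + s - 2)).
        apply Rmult_lt_0_compat; lra.
      * intros t _. auto_derive. exact I.
      * intros tau Htau. simpl sl_p; simpl sl_q; simpl sl_r.
        (* The factor 3 / mu^2 undoes mu^2 / 3, so the cube root returns tau - 1 and 1 + cbrt(...)
           is tau. *)
        replace (3 / mu ^ 2 * _) with ((tau - 1) ^ 3) by (field; exact Hmu0).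
        rewrite cbrt_of_pow3. replace (1 + (tau - 1)) with tau by ring.
        rewrite (log_oscillation_pow4 mu) by assumption. repeat split.
      * rewrite Rplus_0_l. now rewrite (log_oscillation_sq mu).
      * rewrite (log_oscillation_sq mu) by lra. reflexivity.
  (* The sine vanishes only at integer multiples of PI, so the assumptions on mu ln m and mu ln (PI
     + m) make both boundary coefficients nonzero and the conditions Dirichlet. *)
  - assert (Hsin : forall c, 0 < c -> (forall n : Z, mu * ln c <> IZR n * PI) ->
              c * sin (mu * ln c) ^ 2 <> 0).
    { intros c Hc Hn. apply Rmult_integral_contrapositive_currified; [lra|].
      apply pow_nonzero. intros H0. apply sin_eq_0_0 in H0 as [n H0]. now apply (Hn n). }
    intros u. unfold sl_boundary. simpl sl_delta; simpl sl_gamma.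
    split.
    + intros [Ha Hb]. split.
      * destruct (Rmult_integral _ _ Ha) as [H | H]; [now apply Hsin in H | exact H].
      * destruct (Rmult_integral _ _ Hb) as [H | H]; [apply Hsin in H; [easy | lra | easy] | exact H].
    + intros [Ha Hb]. rewrite Ha, Hb. split; ring.
Qed.
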